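(* Let $y_0\in ND(P(0))$. The following statements hold. (i) There is no $y_1\in\bigcup_{\Delta\in P(Z,Y)}\Phi(\Delta)$ such that $y_0<y_1$. In particular, there is no $y_1\in\mathrm{WMax}(D(0))$ such that $y_0<y_1$. (ii) Assume that there exists $x_1\in\Omega$ with $G(x_1)\cap(-\mathrm{int}(Z_+))\ne\emptyset$. Then there exists $\Delta_0\in\Gamma_{y_0}\subset P(Z,Y)$ such that $y_0\in\Phi(\Delta_0)$, that is, $y_0\in\mathrm{cl}(\Psi(\Delta_0))$ and $y_0$ is nondominated by $\Psi(\Delta_0)$. Furthermore, if $y_0\in F(x_0)$ for a feasible solution $x_0\in S(0)$, then the nondominated point $y_0$ is also achieved at $x_0$, i.e. $y_0\in F(x_0)+\Delta_0(G(x_0)+Z_+)$, and $\Delta_0(G(x_0)+Z_+)\cap(-Y_+)\subseteq Y_+\cap(-Y_+)$.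
   Context: Setting. $X,Y,Z$ are real normed spaces with topological duals $X^*,Y^*,Z^*$. $Y_+\subset Y$ and $Z_+\subset Z$ are convex cones (a cone is a nonempty set $K$ with $\alpha K\subset K$ for all real $\alpha\ge 0$) which are proper ($\{0\}\ne K$ and $K$ is not the whole space) and solid (nonempty interior). $Y_+$ preorders $Y$: $y_1\le y_2$ iff $y_2-y_1\in Y_+$; and $y_1<y_2$ means $y_2-y_1\in\mathrm{int}(Y_+)$. $\Omega\subset X$ is a nonempty convex set, $F:\Omega\rightrightarrows Y$ and $G:\Omega\rightrightarrows Z$ are set-valued maps, $F$ is $Y_+$-convex (i.e. $\{(x,y): x\in\Omega,\ y\in F(x)+Y_+\}$ is convex) and $G$ is $Z_+$-convex. Sums of sets are Minkowski sums, with $A+\emptyset=\emptyset$. For a set-valued map $H$, $\mathrm{Graph}(H)=\{(u,v): v\in H(u)\}$, $\mathrm{Dom}(H)=\{u: H(u)\ne\emptyset\}$, $H(A)=\bigcup_{a\in A}H(a)$ for $A\subset\mathrm{Dom}(H)$. The parametric problem $(P(z))$, $z\in Z$, is: Min $F(x)$ such that $x\in\Omega$, $G(x)\cap(z-Z_+)\ne\emptyset$. Put $S(z)=\{x\in\Omega: G(x)\cap(z-Z_+)\neq\emptyset\}$ (assumed contained in $\mathrm{Dom}(F)$, so that the next image is defined), $V(z)=F(S(z))$, $(V+Y_+)(z)=V(z)+Y_+$. Elements of $S(0)$ are the feasible solutions of $(P(0))$. A point $y_0\in Y$ is nondominated by $A\subset Y$ if $A\cap(y_0-Y_+)\subset y_0+Y_+$.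 $ND(P(0))$ is the set of $y_0\in\mathrm{cl}(V(0))$ that are nondominated by $V(0)$. A process is a set-valued map whose graph is a cone; it is convex/closed if its graph is convex/closed. $P(Z,Y)$ is the set of closed convex processes $\Delta:Z\rightrightarrows Y$ with $\mathrm{Dom}(\Delta)=Z$. For $y_0\in ND(P(0))$, $\mathcal S_{Y_+}(y_0)$ is the set of $(z^*,y^* )\in Z^*\times Y^*$ with $\langle z^*,z'\rangle+\langle y^*,y'\rangle\le\langle y^*,y_0\rangle\le\langle z^*,z\rangle+\langle y^*,y\rangle$ for all $(z',y')\in(-Z_+)\times(y_0-Y_+)$ and all $(z,y)\in\mathrm{Graph}(V+Y_+)$; and $\mathcal S'_{Y_+}(y_0)=\mathcal S_{Y_+}(y_0)\setminus\{(0,0)\}$. For $(z^*,y^* )\ne(0,0)$, $S_{(z^*,y^* )}:Z\rightrightarrows Y$ is $S_{(z^*,y^* )}(z)=\{y\in Y:\langle z^*,z\rangle+\langle y^*,y\rangle\le0\}$, and $(-S_{(z^*,y^* )})(z)=-(S_{(z^*,y^* )}(z))$. Define $\Lambda_{(z^*,y^* )}=\{\Delta\in P(Z,Y): \mathrm{Graph}(\Delta)\setminus\{(0,0)\}\subseteq\mathrm{int}(\mathrm{Graph}(-S_{(z^*,y^* )}))\}$ and $\Gamma_{y_0}=\bigcup_{(z^*,y^* )\in\mathcal S'_{Y_+}(y_0)}\Lambda_{(z^*,y^* )}$. Dual problem. For $\Delta\in P(Z,Y)$ put $\Psi(\Delta)=\bigcup_{x\in\Omega}(F(x)+\Delta(G(x)+Z_+))$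 and $\Phi(\Delta)=\{y\in\mathrm{cl}(\Psi(\Delta)): (y-Y_+)\cap\Psi(\Delta)\subseteq y+Y_+\}$. The dual problem $(D(0))$ is: WMax $\Phi(\Delta)$ such that $\Delta\in P(Z,Y)$. $\mathrm{WMax}(D(0))$ is the set of weak maximal points of $(D(0))$: those $y_1\in\bigcup_{\Delta\in P(Z,Y)}\Phi(\Delta)$ for which there is no $y'\in\bigcup_{\Delta\in P(Z,Y)}\Phi(\Delta)$ with $y_1<y'$. *)

(* Defs.v *)
From mathcomp Require Import all_boot all_order all_algebra.
From mathcomp Require Import boolp classical_sets functions reals.
From mathcomp Require Import interval_inference topology normedtype convex.

Set Implicit Arguments.
Unset Strict Implicit.
Unset Printing Implicit Defensive.

Import Order.TTheory GRing.Theory Num.Theory.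
Import numFieldNormedType.Exports.

Local Open Scope classical_set_scope.
Local Open Scope ring_scope.

Declare Scope vopt_scope.
Delimit Scope vopt_scope with vopt.

(* Minkowski operations; a sum with an empty summand is empty. *)
Definition addset (V : zmodType) (A B : set V) : set V :=
  [set a + b | a in A & b in B].
Definition oppset (V : zmodType) (A : set V) : set V := [set - a | a in A].

Notation "A \+m B" := (addset A B)
  (at level 50, left associativity) : vopt_scope.
Notation "A \-m B" := (addset A (oppset B))
  (at level 50, left associativity) : vopt_scope.
Local Open Scope vopt_scope.

Section set_valued_maps.
Context (U V : Type).
Implicit Types H : U -> set V.

Definition graph H : set (U * V) := [set p | H p.1 p.2].
Definition dom H : set U := [set u | H u !=set0].
Definition setimage H (A : set U) : set V := \bigcup_(a in A) H a.

End set_valued_maps.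

Section cones.
Context (R : realType) (V : normedModType R).
Implicit Types K : set V.

Definition cone K := K !=set0 /\ forall a k, 0 <= a -> K k -> K (a *: k).
Definition proper_cone K := K <> [set 0] /\ K <> setT.
Definition solid K := interior K !=set0.

Definition strictly_below K (y1 y2 : V) := interior K (y2 - y1).

Definition nondominated K (A : set V) (y : V) :=
  A `&` ([set y] \-m K) `<=` [set y] \+m K.

Definition dual_space : set {linear V -> R^o} := [set f | continuous f].

End cones.

Section vector_optimization.
Context (R : realType) (X Y Z : normedModType R).
Context (Yp : set Y) (Zp : set Z).
Context (Omega : set X).

(* A set-valued map on [Omega] is a total function [X -> set _]; its values
   outside [Omega] are never used. *)
Definition cone_convex_map (W : normedModType R) (Wp : set W)
    (H : X -> set W) :=
  @convex_set R (X * W)%type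
    [set p : X * W | Omega p.1 /\ (H p.1 \+m Wp) p.2].

Context (F : X -> set Y) (G : X -> set Z).

Definition feasible (z : Z) : set X :=
  [set x | Omega x /\ G x `&` ([set z] \-m Zp) !=set0].
Definition primal_image (z : Z) : set Y := setimage F (feasible z).
Definition primal_image_up (z : Z) : set Y := primal_image z \+m Yp.

Definition ND : set Y :=
  [set y | closure (primal_image 0) y /\ nondominated Yp (primal_image 0) y].

Definition closed_convex_processes : set (Z -> set Y) :=
  [set D | [/\ cone (graph D : set (Z * Y)%type),
               @convex_set R (Z * Y)%type (graph D),
               closed (graph D : set (Z * Y)%type) & dom D = setT]].

Local Notation functionals :=
  ({linear Z -> R^o} * {linear Y -> R^o})%type.

Definition multipliers (y0 : Y) : set functionals :=
  [set m | [/\ dual_space m.1, dual_space m.2 &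
    forall z' y' z y, oppset Zp z' -> ([set y0] \-m Yp) y' ->
      graph primal_image_up (z, y) ->
      m.1 z' + m.2 y' <= m.2 y0 <= m.1 z + m.2 y]].

Definition nonzero_multipliers (y0 : Y) :=
  multipliers y0 `\`
  [set m : functionals | (forall z, m.1 z = 0) /\ (forall y, m.2 y = 0)].

Definition halfspace_process (m : functionals) :
  Z -> set Y := fun z => [set y | m.1 z + m.2 y <= 0].
Definition opp_halfspace_process (m : functionals) :
  Z -> set Y := fun z => oppset (halfspace_process m z).

Definition Lambda (m : functionals) :
    set (Z -> set Y) :=
  [set D | closed_convex_processes D /\
    graph D `\` [set (0, 0)] `<=`
      interior (graph (opp_halfspace_process m) : set (Z * Y)%type)].

Definition Gamma (y0 : Y) : set (Z -> set Y) :=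
  \bigcup_(m in nonzero_multipliers y0) Lambda m.

Definition Psi (D : Z -> set Y) : set Y :=
  \bigcup_(x in Omega) (F x \+m setimage D (G x \+m Zp)).

Definition Phi (D : Z -> set Y) : set Y :=
  [set y | closure (Psi D) y /\ ([set y] \-m Yp) `&` Psi D `<=` [set y] \+m Yp].

Definition dual_image : set Y := \bigcup_(D in closed_convex_processes) Phi D.

Definition WMax : set Y :=
  [set y1 | dual_image y1 /\
    ~ exists y', dual_image y' /\ strictly_below Yp y1 y'].

End vector_optimization.

Arguments closed_convex_processes {R} Y Z _.

(* Main.v *)
From HB Require Import structures.
Require Import Defs.
From mathcomp Require Import all_boot all_order all_algebra.
From mathcomp Require Import boolp classical_sets functions reals.
From mathcomp Require Import interval_inference topology normedtype convex.
From mathcomp Require Import prodnormedzmodule.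
From mathcomp Require Import ring lra.

Set Implicit Arguments.
Unset Strict Implicit.
Unset Printing Implicit Defensive.

Import Order.TTheory GRing.Theory Num.Theory.
Import numFieldNormedType.Exports.

Local Open Scope classical_set_scope.
Local Open Scope ring_scope.
Local Open Scope vopt_scope.

(** Weak duality holds because [Psi] relaxes the primal problem: a process
    satisfies [D 0 0], so every primal value lies in [Psi D].  If [y1] is in
    [Phi D] and [y0 < y1], then some primal value [f] close to [y0] satisfies
    [f < y1]; as [y1] is nondominated by [Psi D] this forces [y1 <= f], and a
    convex cone containing both an interior point and its opposite is the whole
    space, which properness excludes ([weak_duality]).

    Strong duality is a Lagrange multiplier argument.  Because [y0] is
    nondominated, the convex set [Graph(V + Y_+)] misses the interior of
    [- Z_+ x (y0 - Y_+)], and separating the two gives a nonzero pair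
    [m = (m1, m2)] of continuous functionals, nonnegative on [Z_+] and [Y_+],
    with [m2 y0 <= m1 z + m2 y] on the graph ([multipliers_exist]).  Slater's
    condition forces [m2 <> 0] ([slater_regular]).  Then
    [g (z, w) = m2 w - m1 z] takes arbitrarily large values on every fibre
    [{z} x Y], and for small [d > 0] the Bishop-Phelps cone
    [d |(z, w)| <= g (z, w)] is the graph of a closed convex process with full
    domain, on which [g > 0] away from the origin ([strict_process]).
    For [f] in [F x] and [w] in [D z] with [z] in [G x + Z_+] one has
    [m2 y0 <= m1 z + m2 f <= m2 (f + w)], strictly unless [(z, w) = (0, 0)].
    So an element [f + w <= y0] of [Psi D] is in fact a primal value
    ([nondominated_Psi]), and when [f = y0] the only [w <= 0] is [0]
    ([complementarity]).

    The separation theorem is derived from Zorn's lemma: among the convex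
    cones that contain a given cone and avoid [- u], a maximal one [P]
    satisfies [P \/ - P = everything] ([maximal_cone]), so
    [x |-> sup {t | x - t u \in P}] is linear ([total_cone_functional]).  To
    separate [p] from [E], apply this to the cone generated by [E - p] and the
    ordering cone ([interior_cone_separation]). *)

(** * Positive functionals on a convex cone *)

Definition convex_cone (R : realType) (W : lmodType R) (K : set W) :=
  [/\ K 0, forall x y, K x -> K y -> K (x + y) &
      forall a x, 0 <= a -> K x -> K (a *: x)].

Lemma ex_linear (R : realType) (W : lmodType R) (f : W -> R^o) :
  linear f -> exists g : {linear W -> R^o}, forall x, g x = f x.
Proof.
move=> lf; pose i := GRing.isLinear.Build R W R^o *:%R f lf.
pose g : {linear W -> R^o} := HB.pack f i.
by exists g.
Qed.

Section maximal_cone.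
Context (R : realType) (W : lmodType R) (K : set W) (u : W).
Hypothesis (coneK : convex_cone K) (nKu : ~ K (- u)).

(** If neither [x] nor [- x] belonged to a maximal [P], both extensions of [P]
    would capture [- u]: [- u = p + a x = q - b x] with [a, b > 0], and then
    [- (a + b) u = b p + a q] would be in [P]. *)
Lemma maximal_cone : exists P : set W, [/\ convex_cone P, K `<=` P, ~ P (- u) &
  forall x, P x \/ P (- x)].
Proof.
have [K0 KD KZ] := coneK.
(* Containing [K] is replaced by stability under adding elements of [K], so
   that the empty set, the union of the empty chain, qualifies; a nonempty
   such set contains 0, hence [K]. *)
pose Q (A : set W) := [/\ forall x y, A x -> A y -> A (x + y),
  forall a x, 0 <= a -> A x -> A (a *: x),
  forall x k, A x -> K k -> A (x + k) & ~ A (- u)].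
have [F FQ Ftot|P [[PD PZ PK nPu] Pmax]] := @Zorn_bigcup W Q.
  split.
  - move=> x y [A FA Ax] [B FB By].
    have [AB|BA] := Ftot _ _ FA FB.
      by exists B => //; have [BD _ _ _] := FQ _ FB; apply: BD => //; exact: AB.
    by exists A => //; have [AD _ _ _] := FQ _ FA; apply: AD => //; exact: BA.
  - by move=> a x a0 [A FA Ax]; exists A => //;
      have [_ + _ _] := FQ _ FA; apply.
  - by move=> x k [A FA Ax] Kk; exists A => //;
      have [_ _ + _] := FQ _ FA; apply.
  - by case=> A FA; have [_ _ _] := FQ _ FA.
have P0 : P 0.
  apply: contrapT => nP0.
  have Pe x : P x -> False by move/(PZ 0 x (lexx 0)); rewrite scale0r.
  apply: (Pmax K); last by split.
  by split=> [x /Pe //|/(_ 0 K0)].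
have KP : K `<=` P by move=> k /(PK _ _ P0); rewrite add0r.
have extend x : ~ P x -> exists p a, [/\ P p, 0 < a & - u = p + a *: x].
  move=> nPx.
  pose B := [set w | exists p a, [/\ P p, 0 <= a & w = p + a *: x]].
  have PB : P `<` B.
    split=> [p Pp|/(_ x) BP]; first by exists p, 0; rewrite scale0r addr0.
    by apply/nPx/BP; exists 0, 1; rewrite scale1r add0r ler01.
  have [p [a [Pp a0 e]]] : B (- u).
    apply: contrapT => nBu; apply: (Pmax B) => //; split=> //.
    - move=> _ _ [p [a [Pp a0 ->]]] [q [b [Pq b0 ->]]].
      exists (p + q), (a + b); split; [exact: PD|exact: addr_ge0|].
      by rewrite addrACA scalerDl.
    - move=> c _ c0 [p [a [Pp a0 ->]]].
      exists (c *: p), (c * a); split; [exact: PZ|exact: mulr_ge0|].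
      by rewrite scalerDr scalerA.
    - move=> _ k [p [a [Pp a0 ->]]] Kk.
      by exists (p + k), a; split=> //; [exact: PK|rewrite addrAC].
  exists p, a; split=> //; rewrite lt_neqAle a0 andbT; apply/eqP => a_0.
  by move: nPu; rewrite e -a_0 scale0r addr0.
exists P; split=> // x.
have [Px|/extend[p [a [Pp a0 ea]]]] := pselect (P x); [by left|right].
apply: contrapT => /extend[q [b [Pq b0 eb]]]; apply: nPu.
have ab0 : 0 < a + b by exact: addr_gt0.
have -> : - u = (a + b)^-1 *: (b *: p + a *: q).
  apply: (scalerI (lt0r_neq0 ab0)); rewrite scalerA mulfV ?lt0r_neq0//.
  rewrite scale1r scalerDl {1}eb ea !scalerDr !scalerN !scalerA.
  by rewrite (mulrC b a) addrC addrACA addrN addr0.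
by apply/PZ; [rewrite invr_ge0 ltW|apply: PD; apply/PZ => //; exact: ltW].
Qed.

End maximal_cone.

Section total_cone_functional.
Context (R : realType) (W : lmodType R) (P : set W) (u : W).
Hypothesis (coneP : convex_cone P) (Ptot : forall x, P x \/ P (- x)).
Hypothesis (nPu : ~ P (- u)) (unitP : forall x, exists a, P (x + a *: u)).

Let f (x : W) : R^o := sup [set t : R | P (x - t *: u)].

Let PuZ t : P (t *: u) <-> 0 <= t.
Proof.
have [_ _ PZ] := coneP; split=> [Ptu|t0].
  rewrite leNgt; apply/negP => t0; apply: nPu.
  have -> : - u = (- t)^-1 *: (t *: u).
    by rewrite scalerA invrN mulNr mulVf ?scaleN1r// lt_eqF.
  by apply: PZ => //; rewrite invr_ge0 oppr_ge0 ltW.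
by apply: PZ => //; case: (Ptot u).
Qed.

(* The values [t] with [x - t u \in P] and those with [t u - x \in P] form a
   Dedekind cut of the line, whose cut point is [f x]. *)
Let cut x s t : P (x - s *: u) -> P (t *: u - x) -> s <= t.
Proof.
have [_ PD _] := coneP.
move=> /PD /[apply]; rewrite addrC subrKA -scalerBl => /PuZ.
by rewrite subr_ge0.
Qed.

Let f_uniq x c : (forall t, t < c -> P (x - t *: u)) ->
  (forall t, c < t -> P (t *: u - x)) -> f x = c.
Proof.
move=> lo hi; apply/eqP; rewrite eq_le; apply/andP; split.
  apply: ge_sup; first by exists (c - 1); apply: lo; rewrite gtrBl.
  move=> s Ps; apply/ler_addgt0Pr => e e0; apply: cut Ps _; apply: hi.
  by rewrite ltrDl.
apply/ler_addgt0Pr => e e0; rewrite -lerBlDr; apply: ub_le_sup.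
  by exists (c + 1) => s Ps; apply: cut Ps _; apply: hi; rewrite ltrDl.
by apply: lo; rewrite gtrBl.
Qed.

Let f_lo x t : t < f x -> P (x - t *: u).
Proof.
have [_ PD PZ] := coneP.
have [a Pa] := unitP x; have [b Pb] := unitP (- x).
have supS : has_sup [set t : R | P (x - t *: u)].
  split; first by exists (- a); rewrite /= scaleNr opprK.
  by exists b => s Ps; apply: cut Ps _; rewrite addrC.
rewrite -subr_gt0 => /sup_adherent/(_ supS)[s Ps ts].
rewrite -[sup _]/(f x) subKr in ts.
have -> : x - t *: u = x - s *: u + (s - t) *: u.
  by rewrite scalerBl addrA subrK.
by apply: PD => //; apply/PuZ; rewrite subr_ge0 ltW.
Qed.

Let f_hi x t : f x < t -> P (t *: u - x).
Proof.
move=> xt; rewrite -opprB; have [Ps|//] := Ptot (x - t *: u).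
suff : t <= f x by rewrite leNgt xt.
have [b Pb] := unitP (- x).
by apply: ub_le_sup => //; exists b => s; move/cut; apply; rewrite addrC.
Qed.

Let f_linear : linear f.
Proof.
have [P0 PD PZ] := coneP.
have fD x y : f (x + y) = f x + f y.
  apply: f_uniq => t xyt.
    pose e := (f x + f y - t) / 2.
    have e0 : 0 < e by rewrite divr_gt0// subr_gt0.
    have -> : x + y - t *: u = (x - (f x - e) *: u) + (y - (f y - e) *: u).
      rewrite addrACA -opprD -scalerDl; congr (_ - _ *: _).
      by rewrite /e; field.
    by apply: PD; apply: f_lo; rewrite gtrBl.
  pose e := (t - (f x + f y)) / 2.
  have e0 : 0 < e by rewrite divr_gt0// subr_gt0.
  have -> : t *: u - (x + y) = ((f x + e) *: u - x) + ((f y + e) *: u - y).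
    by rewrite addrACA -opprD -scalerDl; congr (_ *: _ - _); rewrite /e; field.
  by apply: PD; apply: f_hi; rewrite ltrDl.
have f0 : f 0 = 0 by apply: (@addrI _ (f 0)); rewrite -fD !addr0.
have fN x : f (- x) = - f x by apply/eqP; rewrite -addr_eq0 -fD addNr f0.
have fpos a x : 0 < a -> f (a *: x) = a * f x.
  move=> a0; have an := lt0r_neq0 a0; apply: f_uniq => t tfx.
    have -> : a *: x - t *: u = a *: (x - (t / a) *: u).
      by rewrite scalerBr scalerA mulrC divfK.
    by apply: PZ; [exact: ltW|apply: f_lo; rewrite ltr_pdivrMr// mulrC].
  have -> : t *: u - a *: x = a *: ((t / a) *: u - x).
    by rewrite scalerBr scalerA mulrC divfK.
  by apply: PZ; [exact: ltW|apply: f_hi; rewrite ltr_pdivlMr// mulrC].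
move=> a x y; rewrite fD; congr (_ + _).
have [a0|a0|<-] := ltgtP 0 a; [exact: fpos| |by rewrite !scale0r f0].
have := fpos (- a) x; rewrite oppr_gt0 scaleNr fN mulNr => /(_ a0).
exact: oppr_inj.
Qed.

(** Totality of [P] makes the supremum of [{t | x - t u \in P}] both super- and
    subadditive in [x], hence linear. *)
Lemma total_cone_functional : exists f : {linear W -> R^o},
  f u = 1 /\ forall x, P x -> 0 <= f x.
Proof.
have fu : f u = 1.
  apply: f_uniq => t t1.
    by rewrite -{1}[u]scale1r -scalerBl; apply/PuZ; rewrite subr_ge0 ltW.
  by rewrite -{2}[u]scale1r -scalerBl; apply/PuZ; rewrite subr_ge0 ltW.
have [g gf] := ex_linear f_linear; exists g; split; first by rewrite gf.
move=> x Px; rewrite gf leNgt; apply/negP => fx0.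
have := @cut x 0 (f x / 2).
rewrite scale0r subr0 leNgt => /(_ Px); rewrite pmulr_llt0 ?fx0//.
have h : f x < f x / 2 by lra.
by move/(_ (f_hi h)).
Qed.

End total_cone_functional.

(** * Solid convex cones and separation *)

Lemma convex_setP (R : realType) (W : lmodType R) (A : set W) :
  @convex_set R W A <-> forall x y t, 0 <= t -> t <= 1 -> A x -> A y ->
    A (t *: x + (1 - t) *: y).
Proof.
split=> [cA x y t t0 t1 /mem_set Ax /mem_set Ay|
         cA x y t /set_mem Ax /set_mem Ay].
  exact: set_mem (cA x y (Itv01 t0 t1) Ax Ay).
by apply: mem_set; apply: cA.
Qed.

Lemma cone_convex_cone (R : realType) (V : normedModType R) (K : set V) :
  cone K -> @convex_set R V K -> convex_cone K.
Proof.
move=> [[k Kk] KZ] /convex_setP cK; split=> [|x y Kx Ky|a x]; last exact: KZ.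
  by rewrite -(scale0r k); apply: KZ.
have -> : x + y = 2 *: ((1 / 2) *: x + (1 - 1 / 2) *: y).
  rewrite scalerDr !scalerA; have -> : 2 * (1 / 2) = 1 :> R by field.
  by have -> : 2 * (1 - 1 / 2) = 1 :> R by [field]; rewrite !scale1r.
by apply: KZ => //; apply: cK => //; lra.
Qed.

Lemma convex_cone_convex (R : realType) (W : lmodType R) (K : set W) :
  convex_cone K -> @convex_set R W K.
Proof.
move=> [_ KD KZ]; apply/convex_setP => x y t t0 t1 Kx Ky.
by apply: KD; apply: KZ; rewrite ?subr_ge0.
Qed.

Lemma convex_cone_cone (R : realType) (V : normedModType R) (K : set V) :
  convex_cone K -> cone K.
Proof. by move=> [K0 _ KZ]; split; [exists 0|]. Qed.

Lemma interior_normP (R : realType) (V : normedModType R) (A : set V) (u : V) :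
  interior A u <-> exists2 r, 0 < r & forall x, `|x| < r -> A (u + x).
Proof.
split=> [/nbhs0P /nbhs_norm0P[r r0 Ar]|[r r0 Ar]].
  by exists r => // x xr; apply: Ar.
by apply/nbhs0P/nbhs_norm0P; exists r.
Qed.

Section solid_cone.
Context (R : realType) (V : normedModType R) (K : set V) (u : V).
Hypotheses (coneK : convex_cone K) (Ku : interior K u).

Lemma interior_coneD k : K k -> interior K (u + k).
Proof.
have [_ KD _] := coneK; have /interior_normP[r r0 Kr] := Ku.
move=> Kk; apply/interior_normP; exists r => // x xr.
by rewrite addrAC; apply: KD => //; exact: Kr.
Qed.

Lemma interior_coneZ a : 0 < a -> interior K (a *: u).
Proof.
have [_ _ KZ] := coneK; have /interior_normP[r r0 Kr] := Ku.
move=> a0; apply/interior_normP; exists (a * r); first exact: mulr_gt0.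
move=> x xr; have -> : a *: u + x = a *: (u + a^-1 *: x).
  by rewrite scalerDr scalerA mulfV ?scale1r// lt0r_neq0.
apply: KZ; first exact: ltW.
by apply: Kr; rewrite normrZ gtr0_norm ?invr_gt0// ltr_pdivrMl.
Qed.

(** An interior point is an order unit: this is the only property of the
    topology that the extension of positive functionals relies on. *)
Lemma interior_order_unit x : exists2 a, 0 < a & K (x + a *: u).
Proof.
have [_ _ KZ] := coneK; have /interior_normP[r r0 Kr] := Ku.
have d0 : 0 < `|x| + 1 by rewrite ltr_wpDl.
exists ((`|x| + 1) / r); first exact: divr_gt0.
have -> : x + ((`|x| + 1) / r) *: u =
    ((`|x| + 1) / r) *: (u + (r / (`|x| + 1)) *: x).
  rewrite scalerDr scalerA addrC; congr (_ + _).
  by rewrite -[LHS]scale1r; congr (_ *: _); field; rewrite !lt0r_neq0.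
apply: KZ; first by rewrite ltW// divr_gt0.
apply: Kr; rewrite normrZ gtr0_norm ?divr_gt0// mulrAC ltr_pdivrMr//.
by rewrite ltr_pM2l// ltrDl.
Qed.

Lemma opp_interior_setT : K (- u) -> K = setT.
Proof.
have [_ KD KZ] := coneK; move=> Knu; apply/seteqP; split=> // x _.
have [a a0 Ka] := interior_order_unit x.
rewrite -(addrK (a *: u) x) -scalerN; apply: KD => //; apply: KZ => //.
exact: ltW.
Qed.

(** On a ball around [0], both [u + x] and [u - x] are in [K], so that
    [|f x| <= f u]. *)
Lemma nonneg_continuous (f : {linear V -> R^o}) :
  (forall k, K k -> 0 <= f k) -> continuous f.
Proof.
move=> fK; apply/linear_bounded_continuous/ex_bound.
exists (f u); apply/nbhs_norm0P; have /interior_normP[r r0 Kr] := Ku.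
exists r => // x /= xr; rewrite ler_norml -subr_ge0 opprK -[_ <= f u]subr_ge0.
rewrite addrC -linearD -linearB; apply/andP; split; apply/fK/Kr => //.
by rewrite normrN.
Qed.

Lemma nonneg_interior_gt0 (f : {linear V -> R^o}) :
  (forall k, K k -> 0 <= f k) -> (exists x, f x != 0) -> 0 < f u.
Proof.
move=> fK [x fx0]; rewrite lt_neqAle fK ?andbT; last exact: interior_subset.
apply: contra fx0 => /eqP fu0.
have [a a0 /fK] := interior_order_unit x.
have [b b0 /fK] := interior_order_unit (- x).
rewrite !linearD !linearN !linearZ/= -!fu0 !scaler0 !addr0 oppr_ge0 => h1 h2.
by rewrite eq_le h1.
Qed.

End solid_cone.

(** A functional nonnegative on the convex cone generated by [K] and [E - p]
    separates; this cone avoids [- u], since [- u = a (e - p) + k] would put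
    [p - e = (u + k) / a] in the interior of [K]. *)
Lemma interior_cone_separation (R : realType) (V : normedModType R)
    (K E : set V) (u p : V) :
  convex_cone K -> interior K u ->
  @convex_set R V E -> E !=set0 -> (forall e, E e -> ~ interior K (p - e)) ->
  exists f : {linear V -> R^o}, [/\ continuous f, f u = 1,
    forall k, K k -> 0 <= f k & forall e, E e -> f p <= f e].
Proof.
move=> coneK Ku; have [K0 KD KZ] := coneK.
move=> /convex_setP cE [e0 Ee0] disj.
pose Q := [set w | exists a e k, [/\ 0 <= a, E e, K k & w = a *: (e - p) + k]].
have KQ k : K k -> Q k.
  by move=> Kk; exists 0, e0, k; rewrite scale0r add0r.
have coneQ : convex_cone Q.
  split; first exact: KQ.
  - move=> _ _ [a [e [k [a0 Ee Kk ->]]]] [b [d [l [b0 Ed Kl ->]]]].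
    have [ab0|ab0] := eqVneq (a + b) 0.
      have /andP[/eqP -> /eqP ->] : (a == 0) && (b == 0).
        by rewrite -paddr_eq0// ab0.
      by rewrite !scale0r !add0r; apply/KQ/KD.
    exists (a + b), ((a / (a + b)) *: e + (1 - a / (a + b)) *: d), (k + l).
    have ab_gt0 : 0 < a + b by rewrite lt_neqAle eq_sym ab0 addr_ge0.
    split; [exact: ltW| |exact: KD|].
      apply: cE => //; first by rewrite divr_ge0// ltW.
      by rewrite ler_pdivrMr// mul1r lerDl.
    rewrite addrACA; congr (_ + _); rewrite !scalerBr scalerDr !scalerA.
    rewrite [in LHS]addrACA -opprD -scalerDl; congr (_ *: _ + _ *: _ - _).
      by field.
    by field.
  - move=> c _ c0 [a [e [k [a0 Ee Kk ->]]]].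
    exists (c * a), e, (c *: k); split=> //; [exact: mulr_ge0|exact: KZ|].
    by rewrite scalerDr scalerA.
have nQu : ~ Q (- u).
  move=> [a [e [k [a0 Ee Kk ue]]]]; apply: (disj e Ee).
  have [a_gt0|a_le0] := ltP 0 a.
    have -> : p - e = a^-1 *: (u + k).
      apply: (scalerI (lt0r_neq0 a_gt0)).
      rewrite scalerA mulfV ?lt0r_neq0// scale1r -[u]opprK ue -opprB scalerN.
      by rewrite opprD addrNK.
    have Kuk := interior_coneD coneK Ku Kk.
    by apply: interior_coneZ => //; rewrite invr_gt0.
  have a_0 : a = 0 by apply/le_anti/andP.
  move: ue; rewrite a_0 scale0r add0r => ue.
  by rewrite (opp_interior_setT coneK Ku) ?interiorT// ue.
have [P [coneP QP nPu Ptot]] := maximal_cone coneQ nQu.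
have Punit x : exists a, P (x + a *: u).
  by have [a _ Ka] := interior_order_unit coneK Ku x; exists a; apply/QP/KQ.
have [f [fu fP]] := total_cone_functional coneP Ptot nPu Punit.
have fK k : K k -> 0 <= f k by move=> /KQ/QP/fP.
exists f; split=> //; first exact: (nonneg_continuous Ku).
move=> e Ee; rewrite -subr_ge0 -linearB; apply/fP/QP.
by exists 1, e, 0; rewrite scale1r addr0.
Qed.

(** Any functional on [Z * Y] splits as [(z, y) |-> f1 z + f2 y]; continuity of
    both parts comes for free from nonnegativity on solid cones. *)
Lemma product_separation (R : realType) (Y Z : normedModType R)
    (Yp : set Y) (Zp : set Z) (E : set (Z * Y)%type) (z0 : Z) (y0 : Y) :
  convex_cone Yp -> convex_cone Zp -> solid Yp -> solid Zp ->
  @convex_set R (Z * Y)%type E -> E !=set0 ->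
  (forall z y, E (z, y) -> interior Zp (z0 - z) -> ~ interior Yp (y0 - y)) ->
  exists m : {linear Z -> R^o} * {linear Y -> R^o},
    [/\ dual_space m.1, dual_space m.2,
      ~ ((forall z, m.1 z = 0) /\ (forall y, m.2 y = 0)),
      (forall z, Zp z -> 0 <= m.1 z) /\ (forall y, Yp y -> 0 <= m.2 y) &
      forall z y, E (z, y) -> m.1 z0 + m.2 y0 <= m.1 z + m.2 y].
Proof.
move=> [Y0 YD YZ] [Z0 ZD ZZ] [y1 Yy1] [z1 Zz1] cE E0 disj.
pose C : set (Z * Y)%type := [set p | Zp p.1 /\ Yp p.2].
have coneC : convex_cone C.
  split=> [//|x y [? ?] [? ?]|a x a0 [? ?]]; split=> /=;
    by [exact: ZD|exact: YD|exact: ZZ|exact: YZ].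
have intC z y : interior C (z, y) <-> interior Zp z /\ interior Yp y.
  split=> [/interior_normP[r r0 rC]|
    [/interior_normP[r r0 rZ] /interior_normP[s s0 sY]]].
    have rZY a b : `|a| < r -> `|b| < r -> Zp (z + a) /\ Yp (y + b).
      move=> ar br; apply: (rC (a, b)).
      by rewrite prod_normE gt_max; apply/andP.
    split; apply/interior_normP; exists r => // x xr.
      by have [] := rZY x 0; rewrite ?normr0.
    by have [] := rZY 0 x; rewrite ?normr0.
  apply/interior_normP; exists (Num.min r s); first by rewrite lt_min r0.
  move=> [a b]; rewrite prod_normE/= gt_max !lt_min.
  move=> /andP[/andP[ar _] /andP[_ bs]].
  by split; [exact: rZ|exact: sY].
have disjC e : E e -> ~ interior C ((z0, y0) - e).
  by case: e => z y Ezy /intC[]; exact: disj.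
have Cu : interior C (z1, y1) by apply/intC.
have [f [fc fu fC fE]] := interior_cone_separation coneC Cu cE E0 disjC.
have [|f1 f1E] := @ex_linear R Z (fun z => f (z, 0)).
  move=> a x y; rewrite -linearZ -linearD; congr (f _).
  by apply: injective_projections => /=; rewrite ?scaler0 ?addr0.
have [|f2 f2E] := @ex_linear R Y (fun y => f (0, y)).
  move=> a x y; rewrite -linearZ -linearD; congr (f _).
  by apply: injective_projections => /=; rewrite ?scaler0 ?addr0.
have fD z y : f (z, y) = f1 z + f2 y.
  rewrite f1E f2E -linearD; congr (f _).
  by apply: injective_projections => /=; rewrite ?add0r ?addr0.
have f1p z : Zp z -> 0 <= f1 z by move=> Zpz; rewrite f1E; apply: fC.
have f2p y : Yp y -> 0 <= f2 y by move=> Ypy; rewrite f2E; apply: fC.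
exists (f1, f2); split=> //=.
- exact: (nonneg_continuous Zz1).
- exact: (nonneg_continuous Yy1).
- move=> [f10 f20]; move: fu; rewrite fD f10 f20 addr0 => /esym/eqP.
  by rewrite oner_eq0.
- by move=> z y Ezy; rewrite -!fD; exact: fE.
Qed.

(** * A closed convex process inside an open half-space *)

Section bishop_phelps.
Context (R : realType) (W : normedModType R) (g : {linear W -> R^o}) (d : R).

Definition bishop_phelps_cone : set W := [set w | d * `|w| <= g w].

Lemma bishop_phelps_convex_cone : 0 <= d -> convex_cone bishop_phelps_cone.
Proof.
move=> d0; split=> [|x y xB yB|a x a0 xB]; rewrite /bishop_phelps_cone/=.
- by rewrite normr0 mulr0 linear0.
- rewrite linearD (le_trans _ (lerD xB yB))// -mulrDr ler_wpM2l//.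
  exact: ler_normD.
- by rewrite linearZ normrZ ger0_norm// mulrCA ler_wpM2l.
Qed.

Lemma bishop_phelps_closed : continuous g -> closed bishop_phelps_cone.
Proof.
move=> gc; pose h w : R := g w - d * `|w|.
have -> : bishop_phelps_cone = h @^-1` [set t | 0 <= t].
  by apply/seteqP; split=> w; rewrite /bishop_phelps_cone/h/= subr_ge0.
apply: closed_comp; last exact: closed_ge.
move=> w _; apply: cvgB; first exact: gc.
by apply: cvgM; [exact: cvg_cst|exact: cvg_norm].
Qed.

Lemma bishop_phelps_gt0 w : 0 < d -> w != 0 -> bishop_phelps_cone w -> 0 < g w.
Proof. by move=> d0 w0; apply: lt_le_trans; rewrite mulr_gt0// normr_gt0. Qed.

End bishop_phelps.

(** The Bishop-Phelps cone of [(z, w) |-> m.2 w - m.1 z] meets every fibre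
    [{z} x Y] provided [m.2 <> 0]: with [m.2 e = 1] and [d |e| = 1/2], moving
    along [t e] increases the functional by [t] and [d |.|] by at most
    [t / 2]. *)
Lemma strict_process (R : realType) (Y Z : normedModType R)
    (m : {linear Z -> R^o} * {linear Y -> R^o}) :
  dual_space m.1 -> dual_space m.2 -> (exists y, m.2 y != 0) ->
  exists D : Z -> set Y, Lambda m D /\
    forall z w, D z w -> (z, w) <> (0, 0) -> m.1 z < m.2 w.
Proof.
move=> m1c m2c [y my0].
have [|g gE] := @ex_linear R (Z * Y)%type (fun p => m.2 p.2 - m.1 p.1).
  move=> a [z w] [z1 w1]; rewrite /= !linearP addrACA; congr (_ + _).
  by rewrite -scalerDr.
have gc : continuous g.
  have -> : (g : _ -> _) = (fun p : Z * Y => m.2 p.2 - m.1 p.1) by apply/funext.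
  move=> p; apply: (@cvgB _ _ _ (nbhs p)).
    by apply: continuous_comp; [exact: cvg_snd|exact: m2c].
  by apply: continuous_comp; [exact: cvg_fst|exact: m1c].
have [e me] : exists e, m.2 e = 1.
  by exists ((m.2 y)^-1 *: y); rewrite linearZ; exact: mulVf.
have e0 : 0 < `|e|.
  rewrite normr_gt0; apply/eqP => e0; move: me; rewrite e0 linear0 => /esym/eqP.
  by rewrite oner_eq0.
pose d := (2 * `|e|)^-1.
have d0 : 0 < d by rewrite invr_gt0 mulr_gt0.
pose D z : set Y := [set w | @bishop_phelps_cone R (Z * Y)%type g d (z, w)].
have graphD : graph D = @bishop_phelps_cone R (Z * Y)%type g d.
  by apply/seteqP; split=> -[].
have Dstrict z w : D z w -> (z, w) <> (0, 0) -> m.1 z < m.2 w.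
  move=> Dzw /eqP zw0; rewrite -subr_gt0 -[_ - _](gE (z, w)).
  exact: bishop_phelps_gt0 d0 zw0 Dzw.
exists D; split=> //; split.
  have coneD := bishop_phelps_convex_cone g (ltW d0).
  split; rewrite ?graphD.
  - exact: convex_cone_cone.
  - exact: convex_cone_convex.
  - exact: bishop_phelps_closed.
  apply/seteqP; split=> // z _.
  (* [t] solves [d (|z| + t |e|) <= t - |m.1 z|], given [d |e| = 1/2]. *)
  pose t := 2 * (d * `|z| + `|m.1 z|).
  have t0 : 0 <= t by rewrite mulr_ge0// addr_ge0// mulr_ge0// ltW.
  exists (t *: e); rewrite /D /bishop_phelps_cone/= gE/=.
  have -> : m.2 (t *: e) = t by rewrite linearZ/= me; exact: mulr1.
  have zte : `|(z, t *: e) : Z * Y| <= `|z| + t * `|e|.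
    rewrite prod_normE ge_max/= normrZ ger0_norm// lerDl lerDr normr_ge0 andbT.
    by rewrite mulr_ge0.
  rewrite (le_trans (ler_wpM2l (ltW d0) zte))// mulrDr mulrCA.
  have -> : d * `|e| = 1 / 2 by rewrite /d; field; rewrite lt0r_neq0.
  have := ler_norm (m.1 z); rewrite /t; lra.
have gt0_open : open [set p : Z * Y | 0 < g p].
  by move/continuousP: gc => /(_ _ (@open_gt R 0)).
have gt0_sub : [set p : Z * Y | 0 < g p] `<=` graph (opp_halfspace_process m).
  move=> [z w]; rewrite /= gE/= subr_gt0 => /ltW zw.
  by exists (- w); rewrite ?opprK// /halfspace_process/= linearN subr_le0.
move=> [z w] [Dzw zw0]; apply: (interiorS gt0_sub).
rewrite (interior_id _).1//= gE/= subr_gt0; exact: Dstrict.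
Qed.

(** * The primal problem *)

Section minkowski.
Context (V : zmodType) (K : set V).

Lemma sub1setP y x : ([set y] \-m K) x <-> K (y - x).
Proof.
split=> [[_ -> [_ [k Kk <-] <-]]|Kyx]; first by rewrite opprD addNKr opprK.
exists y => //; exists (x - y); last by rewrite subrKC.
by exists (y - x); rewrite ?opprB.
Qed.

Lemma add1setP y x : ([set y] \+m K) x <-> K (x - y).
Proof.
split=> [[_ -> [k Kk <-]]|Kxy]; first by rewrite addrC addKr.
by exists y => //; exists (x - y) => //; rewrite subrKC.
Qed.

End minkowski.

Lemma nondominated_not_above (R : realType) (Y : normedModType R)
    (Yp A : set Y) (y f : Y) :
  convex_cone Yp -> Yp <> setT -> nondominated Yp A y -> A f ->
  ~ strictly_below Yp f y.
Proof.
move=> coneY YpT nd Af fy; apply: YpT; apply: (opp_interior_setT coneY fy).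
rewrite opprB; apply/add1setP; apply: nd; split=> //.
by apply/sub1setP; exact: interior_subset.
Qed.

Section set_valued_problem.
Context (R : realType) (X Y Z : normedModType R) (Yp : set Y) (Zp : set Z).
Context (Omega : set X) (F : X -> set Y) (G : X -> set Z).

Lemma feasibleP x z : feasible Zp Omega G z x <-> Omega x /\ (G x \+m Zp) z.
Proof.
split=> [[Ox [g [Gg /sub1setP Zzg]]]|[Ox [g Gg [k Zk <-]]]]; split=> //.
  by exists g => //; exists (z - g) => //; rewrite subrKC.
by exists g; split=> //; apply/sub1setP; rewrite addrAC subrr add0r.
Qed.

Lemma graph_primal_upP z y : graph (primal_image_up Yp Zp Omega F G) (z, y) <->
  exists x, [/\ Omega x, (G x \+m Zp) z & (F x \+m Yp) y].
Proof.
split=> [[f [x /feasibleP[Ox Gz] Ff] [k Yk /= <-]]|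
         [x [Ox Gz [f Ff [k Yk <-]]]]].
  by exists x; split=> //; exists f => //; exists k.
by exists f; [exists x => //; apply/feasibleP|exists k].
Qed.

Lemma convex_graph_primal_up :
  cone_convex_map Omega Yp F -> cone_convex_map Omega Zp G ->
  @convex_set R (Z * Y)%type (graph (primal_image_up Yp Zp Omega F G)).
Proof.
move=> /convex_setP cF /convex_setP cG; apply/convex_setP.
move=> [z y] [z' y'] t t0 t1 /graph_primal_upP[x [Ox Gz Fy]].
move=> /graph_primal_upP[x' [Ox' Gz' Fy']]; apply/graph_primal_upP.
exists (t *: x + (1 - t) *: x').
have [Ox'' ?] := cF (x, y) (x', y') t t0 t1 (conj Ox Fy) (conj Ox' Fy').
by have [_ ?] := cG (x, z) (x', z') t t0 t1 (conj Ox Gz) (conj Ox' Gz').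
Qed.

(** Feasibility of [x] says that [0] is in [G x + Z_+], and [D 0 0] then lets
    [F x] through unchanged. *)
Lemma primal_sub_Psi (D : Z -> set Y) :
  D 0 0 -> primal_image Zp Omega F G 0 `<=` Psi Zp Omega F G D.
Proof.
move=> D00 f [x /feasibleP[Ox Gx0] Ff]; exists x => //.
by exists f => //; exists 0; [exists 0|rewrite addr0].
Qed.

End set_valued_problem.

(** * Weak and strong duality *)

Section duality.
Context (R : realType) (X Y Z : normedModType R) (Yp : set Y) (Zp : set Z).
Context (Omega : set X) (F : X -> set Y) (G : X -> set Z) (y0 : Y).
Hypotheses (coneY : convex_cone Yp) (coneZ : convex_cone Zp) (YpT : Yp <> setT).
Hypothesis (y0_ND : ND Yp Zp Omega F G y0).

Lemma weak_duality y1 :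
  dual_image Yp Zp Omega F G y1 -> ~ strictly_below Yp y0 y1.
Proof.
move=> [D [[[p Dp] DZ] _ _ _] [_ nd]] y01; have [cl0 _] := y0_ND.
have D00 : D 0 0 by have := DZ 0 p (lexx 0) Dp; rewrite scale0r.
(* [y0] is only in the closure of the primal image, but [y0 < y1] is an open
   condition on [y0]. *)
have [f [Vf y1f]] : primal_image Zp Omega F G 0 `&`
    (fun f => interior Yp (y1 - f)) !=set0.
  apply: cl0; have /interior_normP[r r0 rY] := y01.
  apply/nbhs0P/nbhs_norm0P; exists (r / 2); first exact: divr_gt0.
  move=> x /= xr; apply/interior_normP; exists (r / 2); first exact: divr_gt0.
  move=> z zr; have -> : y1 - (y0 + x) + z = y1 - y0 + (z - x).
    by rewrite opprD !addrA; exact: addrAC.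
  apply: rY.
  rewrite (le_lt_trans (ler_normD _ _))// normrN.
  by rewrite [ltRHS](splitr r) ltrD.
rewrite setIC in nd; apply: (nondominated_not_above coneY YpT nd) y1f.
exact: primal_sub_Psi D00 _ Vf.
Qed.

(** If [(z, y)] in the graph satisfied [z < 0] and [y < y0], then
    some [f <= y] in [V 0] would be strictly below [y0], against the
    nondominance of [y0]. *)
Lemma multipliers_exist :
  solid Yp -> solid Zp ->
  cone_convex_map Omega Yp F -> cone_convex_map Omega Zp G ->
  exists m, [/\ nonzero_multipliers Yp Zp Omega F G y0 m,
    forall z, Zp z -> 0 <= m.1 z, forall y, Yp y -> 0 <= m.2 y &
    forall z y, graph (primal_image_up Yp Zp Omega F G) (z, y) ->
      m.2 y0 <= m.1 z + m.2 y].
Proof.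
move=> solY solZ cF cG; have [cl0 nd] := y0_ND.
have [Y0 YD YZ] := coneY; have [Z0 ZD ZZ] := coneZ.
pose E := graph (primal_image_up Yp Zp Omega F G).
have E0 : E !=set0.
  have [f [Vf _]] := cl0 setT filterT.
  by exists (0, f); exists f => //; exists 0; rewrite ?addr0.
have disj z y : E (z, y) -> interior Zp (0 - z) -> ~ interior Yp (y0 - y).
  move=> /graph_primal_upP[x [Ox [g Gg [k Zk gkz]] [f Ff [l Yl fly]]]] Nz y0y.
  have Vf : primal_image Zp Omega F G 0 f.
    exists x => //; apply/feasibleP; split=> //; exists g => //.
    exists (k + (0 - z)); first by apply: ZD => //; exact: interior_subset.
    by rewrite addrA gkz sub0r addrN.
  apply: (nondominated_not_above coneY YpT nd Vf); rewrite /strictly_below.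
  have -> : y0 - f = y0 - y + l by rewrite -fly opprD addrA subrK.
  exact: interior_coneD.
have [m [m1c m2c mn0 [mZ mY] mE]] := product_separation coneY coneZ solY solZ
  (convex_graph_primal_up cF cG) E0 disj.
have {}mE z y : E (z, y) -> m.2 y0 <= m.1 z + m.2 y.
  by move/mE; rewrite linear0 add0r.
exists m; split=> //; split=> //; split=> //.
move=> _ y' z y [z' /mZ z'0 <-] /sub1setP /mY y'0 /mE ->; rewrite andbT.
by move: y'0; rewrite linearN linearB/=; lra.
Qed.

(** With [m.2 = 0], the functional [m.1] would be nonzero, hence positive on the
    interior of [Z_+], while the multiplier inequality at the Slater point
    [- k] reads [0 <= m.1 (- k)]. *)
Lemma slater_regular (m : {linear Z -> R^o} * {linear Y -> R^o}) :
  nonzero_multipliers Yp Zp Omega F G y0 m ->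
  (forall z, Zp z -> 0 <= m.1 z) ->
  (forall z y, graph (primal_image_up Yp Zp Omega F G) (z, y) ->
      m.2 y0 <= m.1 z + m.2 y) ->
  (forall z, feasible Zp Omega G z `<=` dom F) ->
  (exists x1, Omega x1 /\ G x1 `&` oppset (interior Zp) !=set0) ->
  exists y, m.2 y != 0.
Proof.
have [Y0 _ _] := coneY; have [Z0 _ _] := coneZ.
move=> [_ mn0] mZ mE domF [x [Ox [g [Gk [k Zk kg]]]]].
rewrite -{}kg in Gk.
apply: contrapT => /forallNP m20.
have {}m20 y : m.2 y = 0 by apply/eqP; have /negP := m20 y; rewrite negbK.
have m1n0 : exists z, m.1 z != 0.
  apply: contrapT => /forallNP m10; apply: mn0; split=> // z.
  by apply/eqP; have /negP := m10 z; rewrite negbK.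
have := nonneg_interior_gt0 coneZ Zk mZ m1n0.
have Sx : feasible Zp Omega G (- k) x.
  by apply/feasibleP; split=> //; exists (- k) => //; exists 0; rewrite ?addr0.
have [f Ff] := domF _ _ Sx.
have /mE : graph (primal_image_up Yp Zp Omega F G) (- k, f).
  by exists f; [exists x|exists 0; rewrite ?addr0].
by rewrite !m20 addr0 linearN oppr_ge0 ltNge => ->.
Qed.

Section lagrangian.
Context (m : {linear Z -> R^o} * {linear Y -> R^o}) (D : Z -> set Y).
Hypothesis mY : forall y, Yp y -> 0 <= m.2 y.
Hypothesis mE : forall z y, graph (primal_image_up Yp Zp Omega F G) (z, y) ->
  m.2 y0 <= m.1 z + m.2 y.
Hypothesis D_strict : forall z w, D z w -> (z, w) <> (0, 0) -> m.1 z < m.2 w.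

(* If [(z, w) <> (0, 0)], then [m.2 y0 <= m.1 z + m.2 f < m.2 w + m.2 f <=
   m.2 y0]. *)
Let tight x f z w : Omega x -> (G x \+m Zp) z -> F x f -> D z w ->
  Yp (y0 - (f + w)) -> z = 0 /\ w = 0.
Proof.
have [Y0 _ _] := coneY; move=> Ox Gz Ff Dzw /mY.
have /mE : graph (primal_image_up Yp Zp Omega F G) (z, f).
  apply/graph_primal_upP; exists x; split=> //.
  by exists f => //; exists 0; rewrite ?addr0.
have [[-> ->//]|zw] := pselect ((z, w) = (0, 0)).
rewrite linearB linearD/= subr_ge0 => y0_le fw_le.
have := le_trans fw_le y0_le.
by rewrite addrC lerD2r leNgt D_strict.
Qed.

(** An element of [Psi D] below [y0] uses a zero increment of [D] at [z = 0], so
    it is a primal value, to which the nondominance of [y0] applies. *)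
Lemma nondominated_Psi : nondominated Yp (Psi Zp Omega F G D) y0.
Proof.
have [_ nd] := y0_ND.
move=> y [[x Ox [f Ff [w [z Gz Dzw] fwy]]] /sub1setP y0y].
rewrite -fwy in y0y *; have [z0 w0] := tight Ox Gz Ff Dzw y0y.
rewrite w0 addr0 in y0y *; apply: nd; split; last exact/sub1setP.
by exists x => //; apply/feasibleP; rewrite -z0.
Qed.

Lemma complementarity x0 : Omega x0 -> F x0 y0 ->
  setimage D (G x0 \+m Zp) `&` oppset Yp `<=` [set 0].
Proof.
move=> Ox0 Fy0 w [[z Gz Dzw] [k Yk kw]].
have y0w : Yp (y0 - (y0 + - k)) by rewrite opprD opprK addrA subrr add0r.
rewrite -kw in Dzw *.
by have [_] := tight Ox0 Gz Fy0 Dzw y0w.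
Qed.

End lagrangian.

End duality.

Theorem theorem4p2 (R : realType) (X Y Z : normedModType R)
  (Yp : set Y) (Zp : set Z)
  (Yp_cone : cone Yp) (Yp_convex : @convex_set R Y Yp)
  (Yp_proper : proper_cone Yp) (Yp_solid : solid Yp)
  (Zp_cone : cone Zp) (Zp_convex : @convex_set R Z Zp)
  (Zp_proper : proper_cone Zp) (Zp_solid : solid Zp)
  (Omega : set X) (Omega_neq0 : Omega !=set0)
  (Omega_convex : @convex_set R X Omega)
  (F : X -> set Y) (G : X -> set Z)
  (F_convex : cone_convex_map Omega Yp F)
  (G_convex : cone_convex_map Omega Zp G)
  (feasible_dom : forall z, feasible Zp Omega G z `<=` dom F)
  (y0 : Y) (y0_ND : ND Yp Zp Omega F G y0) :
  (* (i) *)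
  ((~ exists y1, dual_image Yp Zp Omega F G y1 /\ strictly_below Yp y0 y1) /\
   (~ exists y1, WMax Yp Zp Omega F G y1 /\ strictly_below Yp y0 y1)) /\
  (* (ii) *)
  ((exists x1, Omega x1 /\ G x1 `&` oppset (interior Zp) !=set0) ->
   Gamma Yp Zp Omega F G y0 `<=` closed_convex_processes Y Z /\
   exists D0 : Z -> set Y,
     [/\ Gamma Yp Zp Omega F G y0 D0,
         Phi Yp Zp Omega F G D0 y0,
         closure (Psi Zp Omega F G D0) y0,
         nondominated Yp (Psi Zp Omega F G D0) y0 &
         forall x0, feasible Zp Omega G 0 x0 -> F x0 y0 ->
           (F x0 \+m setimage D0 (G x0 \+m Zp)) y0 /\
           setimage D0 (G x0 \+m Zp) `&` oppset Yp `<=` Yp `&` oppset Yp]).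
Proof.
have coneY := cone_convex_cone Yp_cone Yp_convex.
have coneZ := cone_convex_cone Zp_cone Zp_convex.
have [_ YpT] := Yp_proper.
have weak := weak_duality coneY YpT y0_ND.
split; first by split=> [[y1 [/weak]]|[y1 [[/weak]]]].
move=> slater; split; first by move=> D [m _ []].
have [m [mS mZ mY mE]] :=
  multipliers_exist coneY coneZ YpT y0_ND Yp_solid Zp_solid F_convex G_convex.
have m2n0 := slater_regular coneY coneZ mS mZ mE feasible_dom slater.
have [[m1c m2c _] _] := mS.
have [D [LD Dstrict]] := strict_process m1c m2c m2n0.
have [[[p Dp] DZ] _ _ _] := LD.1.
have D00 : D 0 0 by have := DZ 0 p (lexx 0) Dp; rewrite scale0r.
have nd := nondominated_Psi coneY y0_ND mY mE Dstrict.
have clPsi : closure (Psi Zp Omega F G D) y0.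
  by have [cl0 _] := y0_ND; apply: closure_subset cl0; exact: primal_sub_Psi.
exists D; split=> //; [by exists m|by split=> //; rewrite setIC|].
move=> x0 /feasibleP[Ox0 Gx0] Fy0; split.
  by exists y0 => //; exists 0; [exists 0|rewrite addr0].
move=> w /(complementarity coneY mY mE Dstrict Ox0 Fy0) ->.
by have [Y0 _ _] := coneY; split=> //; exists 0; rewrite ?oppr0.
Qed.
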